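(* Let $n,\lambda,\mu,b\in\mathbb C$, $\mu\neq0$, $b\notin\mathbb Z$, $b+n\notin\mathbb Z$. Let $f_+(z)=\sum_{k\geq1}a_kz^k$ and $f_-(z)=\sum_{k\leq0}a_kz^{-k}$, where the coefficients $a_k$ are given by the explicit formulas $$a_k=\frac{\mu^k}{(b)_{k+1}}R_{k,21}\ \text{ for } k\geq1,\qquad a_{-m}=\frac{\mu^m}{(2-n-b)_{m+1}}T_{m,21}\ \text{ for } m\geq0.$$ Then $$z^{-b}\mathcal L\big(z^bf_{\pm}(z^{\pm1})\big)=d_{0\pm}+d_{1\pm}z,$$ $$d_{0+}=\mu(b+1)a_1,\qquad d_{1+}=((b+1)(b+n)+\lambda)a_1+\mu(b+2)a_2,$$ $$d_{0-}=(b(b+n-1)+\lambda)a_0-\mu(b+n-1)a_{-1},\qquad d_{1-}=-\mu(b+n)a_0 .$$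
   Context: $$\mathcal L E=z^2E''+(nz+\mu(1-z^2))E'+(\lambda-\mu nz)E,$$ and $(b)_l=b(b+1)\cdots(b+l-1)$ is the Pochhammer symbol. The matrices are $$M_k=\begin{pmatrix}1+\frac{\lambda}{(k+b)(k+b+n-1)} & \frac{\mu^2}{(k+b)(k+b+n-1)}\\ 1&0\end{pmatrix},\qquad R_k=M_kM_{k+1}\cdots,$$ $$S_m=\begin{pmatrix}1+\frac{\lambda-n+2}{(b-m+1)(b-m+n-2)} & \frac{\mu^2(b-m+n-1)}{(b-m+1)(b-m+n-2)(b-m+n-3)}\\ 1&0\end{pmatrix},\qquad T_m=S_mS_{m+1}\cdots$$ (the infinite products converge), with matrix elements $R_{k,ij}$, $T_{m,ij}$. Both series $f_\pm$ converge on $\mathbb C$. The expression $z^{-b}\mathcal L(z^bg(z))$ is computed with any local branch of $z^b$ and does not depend on the branch. *)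

(* Defs.v *)
From Stdlib Require Import Reals ZArith.
From Coquelicot Require Import Coquelicot.

Open Scope C_scope.

Definition Cexp (z : C) : C :=
  (exp (Re z) * cos (Im z), exp (Re z) * sin (Im z))%R.

Definition not_integer (c : C) : Prop := forall j : Z, c <> RtoC (IZR j).

Fixpoint pochhammer (c : C) (l : nat) : C :=
  match l with
  | O => RtoC 1
  | S l' => pochhammer c l' * (c + INR l')
  end.

(* Limits and sums of complex sequences as total operators; the value is
   unspecified when there is no limit. *)
Definition is_limC (u : nat -> C) (l : C) : Prop :=
  filterlim u eventually (locally l).

Definition limC (u : nat -> C) : C := @iota C_CompleteNormedModule (is_limC u).

Definition sumC (u : nat -> C) : C :=
  @iota C_CompleteNormedModule (@is_series C_AbsRing C_NormedModule u).

Definition mat2 : Type := @matrix C 2 2.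

(* Entry (i, j) counted from 0: the element written "21" is [entry A 1 0]. *)
Definition entry (A : mat2) (i j : nat) : C := coeff_mat (RtoC 0) A i j.

(* M_k M_{k+1} ... M_{k+N-1} *)
Fixpoint matprod (M : nat -> mat2) (k N : nat) : mat2 :=
  match N with
  | O => @Mone C_Ring 2
  | S N' => @Mmult C_Ring 2 2 2 (matprod M k N') (M (k + N')%nat)
  end.

(* Convergence of the partial products only: the limit may be singular. *)
Definition ex_infprod (M : nat -> mat2) (k : nat) : Prop :=
  forall i j : nat, (i < 2)%nat -> (j < 2)%nat ->
    exists l : C, is_limC (fun N => entry (matprod M k N) i j) l.

Definition infprod (M : nat -> mat2) (k : nat) : mat2 :=
  mk_matrix 2 2 (fun i j => limC (fun N => entry (matprod M k N) i j)).

Definition Mmat (n lambda mu b : C) (k : nat) : mat2 :=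
  [[ 1 + lambda / ((INR k + b) * (INR k + b + n - 1)),
     mu ^ 2 / ((INR k + b) * (INR k + b + n - 1)) ],
   [ RtoC 1, RtoC 0 ]].

Definition Smat (n lambda mu b : C) (m : nat) : mat2 :=
  [[ 1 + (lambda - n + 2) / ((b - INR m + 1) * (b - INR m + n - 2)),
     mu ^ 2 * (b - INR m + n - 1)
       / ((b - INR m + 1) * (b - INR m + n - 2) * (b - INR m + n - 3)) ],
   [ RtoC 1, RtoC 0 ]].

Definition Rmat (n lambda mu b : C) (k : nat) : mat2 :=
  infprod (Mmat n lambda mu b) k.

Definition Tmat (n lambda mu b : C) (m : nat) : mat2 :=
  infprod (Smat n lambda mu b) m.

Definition coef (n lambda mu b : C) (k : Z) : C :=
  if (1 <=? k)%Z then
    let k' := Z.to_nat k in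
    mu ^ k' / pochhammer b (k' + 1) * entry (Rmat n lambda mu b k') 1 0
  else
    let m := Z.to_nat (- k) in
    mu ^ m / pochhammer (2 - n - b) (m + 1) * entry (Tmat n lambda mu b m) 1 0.

(* Index j stands for k = j + 1. *)
Definition fplus_term (n lambda mu b z : C) (j : nat) : C :=
  coef n lambda mu b (Z.of_nat (S j)) * z ^ S j.

(* Index m stands for k = - m. *)
Definition fminus_term (n lambda mu b z : C) (m : nat) : C :=
  coef n lambda mu b (- Z.of_nat m) * z ^ m.

Definition fplus (n lambda mu b z : C) : C := sumC (fplus_term n lambda mu b z).

Definition fminus (n lambda mu b z : C) : C := sumC (fminus_term n lambda mu b z).

Definition ex_seriesC (u : nat -> C) : Prop :=
  @ex_series C_AbsRing C_NormedModule u.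

Definition ex_deriveC (f : C -> C) (z : C) : Prop :=
  @ex_derive C_AbsRing C_NormedModule f z.

(* [C_derive] is the complex derivative only where it exists, whence
   [twice_derivable_on] below. *)
Definition Lop (n lambda mu : C) (E : C -> C) (z : C) : C :=
  z ^ 2 * C_derive (C_derive E) z
  + (n * z + mu * (1 - z ^ 2)) * C_derive E z
  + (lambda - mu * n * z) * E z.

Definition twice_derivable_on (U : C -> Prop) (E : C -> C) : Prop :=
  forall z : C, U z -> ex_deriveC E z /\ ex_deriveC (C_derive E) z.

(* [ell] is a continuous branch of the logarithm on the open set [U]; this
   forces 0 to lie outside [U]. *)
Definition log_branch (U : C -> Prop) (ell : C -> C) : Prop :=
  open U /\
  forall z : C, U z -> continuous ell z /\ Cexp (ell z) = z.

(* The branch of z^c determined by the branch [ell] of log z. *)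
Definition power_branch (ell : C -> C) (c z : C) : C := Cexp (c * ell z).

(* Main.v *)
Require Import Defs.
From Stdlib Require Import Reals ZArith Lra Lia.
From Coquelicot Require Import Coquelicot.

Open Scope C_scope.

(** Applied termwise, [z^(-b) L z^b] sends [z^k] to
    [mu (b+k) z^(k-1) + ((b+k)(b+k+n-1) + lambda) z^k - mu (b+k+n) z^(k+1)], so the
    claim says that the coefficients satisfy a three-term recurrence, the edges of
    the summation range leaving [d0 + d1 z].  The recurrence is the relation
    [R_k = M_k R_(k+1)] (resp. [T_m = S_m T_(m+1)]) read on the first column: the second
    row of [M_k] being [(1, 0)], one has [R_(k,21) = R_(k+1,11)].  The products
    converge, with a bound uniform in [k], because the first rows are [(1, 0)] up to
    a summable error; division by the Pochhammer symbols then makes both series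
    entire. *)

(** * Complex differentiation *)

(** The matrices come from normalizing the recurrence. Writing [a_k] as [mu^k / (b)_(k+1)] times
    [r_k] turns it into [r_(k-1) = (1 + alpha_k) r_k + beta_k r_(k+1)] with summable [alpha] and
    [beta]. The step matrices tend to the projection with rows [(1, 0)], [(1, 0)], not to the
    identity, and their infinite product supplies a bounded solution. On the negative side the same
    is done with [2 - n - b] in place of [b]. Under [w = / z] the Euler operator changes sign and
    the raising and lowering terms swap roles, so one lemma on power series serves both signs:
    multiplied by the variable, the expression has only degrees 0, 1, 2, of which the first vanishes
    for [fplus] and the last for [fminus]. The analytic obstacle is that a branch [ell] of the
    logarithm is merely continuous and [Cexp] is given by its real and imaginary parts.
    Differentiability of [Cexp] is drawn from real second-order estimates, that of [ell] from
    inverting [Cexp] locally, and that of power series from a termwise quadratic remainder. *)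

Notation is_deriveC := (@is_derive C_AbsRing C_NormedModule).
Notation is_seriesC := (@is_series C_AbsRing C_NormedModule).

(** Differentiability sees the codomain only through its operations and norm, on which the two
    module structures agree. The product and chain rules are stated with the second one. *)
Lemma is_deriveC_absring (f : C -> C) (z l : C) :
  is_deriveC f z l <-> @is_derive C_AbsRing (AbsRing_NormedModule C_AbsRing) f z l.
Proof. split; intros [[H1 H2 H3] H4]; (split; [split|]; assumption). Qed.

Lemma locally_C_iff (z : C) (P : C -> Prop) :
  locally z P <-> exists d : R, (0 < d)%R /\ forall y : C, (Cmod (y - z) < d)%R -> P y.
Proof.
  rewrite locally_C; split.
  - intros [d Hd]; exists d; split; [apply cond_pos | exact Hd].
  - intros [d [Hd H]]; exists (mkposreal d Hd); exact H.
Qed.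

Lemma is_deriveC_iff (f : C -> C) (z l : C) :
  is_deriveC f z l <->
  forall eps : R, (0 < eps)%R -> exists d : R, (0 < d)%R /\ forall y : C,
    (Cmod (y - z) < d)%R -> (Cmod (f y - f z - (y - z) * l) <= eps * Cmod (y - z))%R.
Proof.
  split.
  - intros [_ H] eps Heps.
    destruct (H z (fun P HP => HP) (mkposreal eps Heps)) as [d Hd].
    exists d; split; [apply cond_pos | exact Hd].
  - intros H; split; [apply (is_linear_scal_l (K := C_AbsRing) (V := C_NormedModule)) |].
    intros x Hx eps.
    replace x with z.
    2:{ apply (is_filter_lim_locally_unique (V := AbsRing_NormedModule C_AbsRing) z x Hx). }
    destruct (H eps (cond_pos eps)) as [d [Hd0 Hd]].
    exists (mkposreal d Hd0); exact Hd.
Qed.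

(** The derivatives of the inverse, of [Cexp] and of power series all come from an explicit
    remainder of this form. *)
Lemma is_deriveC_quadratic (f : C -> C) (z l : C) (d M : R) :
  (0 < d)%R ->
  (forall y : C, (Cmod (y - z) < d)%R ->
     (Cmod (f y - f z - (y - z) * l) <= M * Cmod (y - z) ^ 2)%R) ->
  is_deriveC f z l.
Proof.
  intros Hd H; apply is_deriveC_iff; intros eps Heps.
  pose proof (Rabs_pos M) as HM.
  exists (Rmin d (eps / (Rabs M + 1))); split.
  { apply Rmin_glb_lt; [assumption | apply Rdiv_lt_0_compat; lra]. }
  intros y Hy.
  pose proof (Rlt_le_trans _ _ _ Hy (Rmin_l _ _)) as H1.
  pose proof (Rlt_le_trans _ _ _ Hy (Rmin_r _ _)) as H2.
  pose proof (Cmod_ge_0 (y - z)) as H0.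
  eapply Rle_trans; [apply H; assumption |].
  set (r := Cmod (y - z)) in *.
  apply Rlt_div_r in H2; [| lra].
  pose proof (Rle_abs M).
  replace (M * r ^ 2)%R with (M * r * r)%R by ring.
  apply Rmult_le_compat_r; nra.
Qed.

Lemma is_deriveC_mult (f g : C -> C) (z df dg : C) :
  is_deriveC f z df -> is_deriveC g z dg ->
  is_deriveC (fun y => f y * g y) z (df * g z + f z * dg).
Proof.
  rewrite !is_deriveC_absring; intros Hf Hg.
  apply (is_derive_mult (K := C_AbsRing) f g z df dg Hf Hg Cmult_comm).
Qed.

Lemma is_deriveC_comp (f g : C -> C) (z df dg : C) :
  is_deriveC f (g z) df -> is_deriveC g z dg ->
  is_deriveC (fun y => f (g y)) z (dg * df).
Proof.
  rewrite (is_deriveC_absring g); intros Hf Hg.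
  apply (is_derive_comp (K := C_AbsRing) (V := C_NormedModule) f g z df dg Hf Hg).
Qed.

Lemma is_deriveC_plus (f g : C -> C) (z df dg : C) :
  is_deriveC f z df -> is_deriveC g z dg ->
  is_deriveC (fun y => f y + g y) z (df + dg).
Proof. apply (is_derive_plus (K := C_AbsRing) (V := C_NormedModule)). Qed.

Lemma is_deriveC_const (c z : C) : is_deriveC (fun _ => c) z (RtoC 0).
Proof. apply (is_derive_const (K := C_AbsRing) (V := C_NormedModule)). Qed.

Lemma is_deriveC_local_inverse (f g : C -> C) (z l : C) :
  l <> 0 -> locally z (fun y => f (g y) = y) -> continuous g z ->
  is_deriveC f (g z) l -> is_deriveC g z (/ l).
Proof.
  intros Hl Hfg Hg Hf; apply is_deriveC_iff; intros eps Heps.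
  pose proof (proj1 (Cmod_gt_0 l) Hl) as Hl0.
  (* The first bound absorbs half of [Cmod l], giving [Cmod k * Cmod l <= 2 * Cmod (y - z)] for the
     increment [k] of [g]; the second then brings the error [eta * Cmod k] down to
     [eps * Cmod l * Cmod (y - z)]. *)
  set (eta := Rmin (Cmod l / 2) (eps * Cmod l ^ 2 / 2)).
  assert (Heta : (0 < eta)%R).
  { apply Rmin_glb_lt; [lra |].
    pose proof (pow_lt _ 2 Hl0); nra. }
  destruct (proj1 (is_deriveC_iff _ _ _) Hf eta Heta) as [d [Hd Hfd]].
  assert (H : locally z (fun y => f (g y) = y /\ (Cmod (g y - g z) < d)%R)).
  { apply filter_and; [assumption |].
    apply (Hg (fun v => (Cmod (v - g z) < d)%R)), locally_C_iff.
    exists d; split; [assumption | intros y Hy; exact Hy]. }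
  pose proof (locally_singleton _ _ Hfg) as Hz; simpl in Hz.
  destruct (proj1 (locally_C_iff _ _) H) as [d' [Hd' Hd'']].
  exists d'; split; [assumption |]; intros y Hy.
  destruct (Hd'' y Hy) as [Hy1 Hy2].
  specialize (Hfd _ Hy2); rewrite Hy1, Hz in Hfd.
  set (k := g y - g z) in *.
  assert (He1 : (eta <= Cmod l / 2)%R) by apply Rmin_l.
  assert (He2 : (eta <= eps * Cmod l ^ 2 / 2)%R) by apply Rmin_r.
  assert (Hk : (Cmod k * Cmod l <= 2 * Cmod (y - z))%R).
  { rewrite <- Cmod_mult.
    pose proof (Cmod_triangle (y - z) (- (y - z - k * l))) as Ht.
    replace (y - z + - (y - z - k * l)) with (k * l) in Ht by ring.
    rewrite Cmod_opp in Ht; rewrite Cmod_mult in *.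
    pose proof (Cmod_ge_0 k); nra. }
  replace (k - (y - z) * / l) with (- ((y - z - k * l) / l)) by (field; assumption).
  rewrite Cmod_opp, Cmod_div by assumption.
  apply Rle_div_l; [assumption |].
  eapply Rle_trans; [exact Hfd |].
  apply Rle_trans with (eps * Cmod l ^ 2 / 2 * Cmod k)%R.
  - apply Rmult_le_compat_r; [apply Cmod_ge_0 | assumption].
  - replace (eps * Cmod l ^ 2 / 2 * Cmod k)%R with (eps * Cmod l / 2 * (Cmod k * Cmod l))%R
      by (simpl; field).
    replace (eps * Cmod (y - z) * Cmod l)%R with (eps * Cmod l / 2 * (2 * Cmod (y - z)))%R
      by field.
    apply Rmult_le_compat_l; [| assumption].
    pose proof (Rmult_lt_0_compat _ _ Heps Hl0); lra.
Qed.

Lemma is_deriveC_inv (z : C) : z <> 0 -> is_deriveC Cinv z (- / z ^ 2).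
Proof.
  intros Hz; pose proof (proj1 (Cmod_gt_0 z) Hz) as H0.
  (* The remainder is exactly [(y - z)^2 / (z^2 y)], and this radius keeps [Cmod y] at least
     [Cmod z / 2]. *)
  apply is_deriveC_quadratic with (d := (Cmod z / 2)%R) (M := (2 / Cmod z ^ 3)%R); [lra |].
  intros y Hy.
  assert (Hyz : (Cmod z / 2 <= Cmod y)%R).
  { pose proof (Cmod_triangle y (- (y - z))) as Ht; rewrite Cmod_opp in Ht.
    replace (y + - (y - z)) with z in Ht by ring; lra. }
  assert (Hy0 : y <> 0) by (apply Cmod_gt_0; lra).
  replace (/ y - / z - (y - z) * - / z ^ 2) with ((y - z) ^ 2 / (z ^ 2 * y))
    by (field; auto).
  assert (Hzz : z ^ 2 <> 0) by (apply Cpow_nz; assumption).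
  rewrite Cmod_div by (apply Cmult_neq_0; assumption).
  rewrite Cmod_mult, !Cmod_pow.
  pose proof (pow2_ge_0 (Cmod (y - z))) as Hp.
  pose proof (pow_lt _ 2 H0) as H2.
  unfold Rdiv; rewrite (Rmult_comm (2 * _)).
  apply Rmult_le_compat_l; [assumption |].
  replace (2 * / Cmod z ^ 3)%R with (/ (Cmod z ^ 2 * (Cmod z / 2)))%R by (field; lra).
  apply Rinv_le_contravar; [apply Rmult_lt_0_compat; lra |].
  apply Rmult_le_compat_l; lra.
Qed.

(** * The exponential and the branches of powers *)

Lemma Cmod_le_Rabs (z : C) : (Cmod z <= Rabs (Re z) + Rabs (Im z))%R.
Proof.
  destruct z as [x y]; simpl.
  replace (x, y) with (RtoC x + Ci * RtoC y).
  2:{ apply injective_projections; simpl; ring. }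
  eapply Rle_trans; [apply Cmod_triangle |].
  rewrite Cmod_mult, Cmod_Ci, !Cmod_R; lra.
Qed.

Lemma im_le_Cmod (z : C) : (Rabs (Im z) <= Cmod z)%R.
Proof. eapply Rle_trans; [apply Rmax_r | apply Rmax_Cmod]. Qed.

Lemma Cexp_plus (z w : C) : Cexp (z + w) = Cexp z * Cexp w.
Proof.
  destruct z as [a b], w as [c d]; unfold Cexp; simpl.
  rewrite exp_plus, cos_plus, sin_plus.
  apply injective_projections; simpl; ring.
Qed.

Lemma Cexp_0 : Cexp 0 = 1.
Proof. unfold Cexp; simpl; rewrite exp_0, cos_0, sin_0; apply injective_projections; simpl; ring. Qed.

Lemma Cexp_neq_0 (z : C) : Cexp z <> 0.
Proof.
  intros H.
  assert (E : Cexp z * Cexp (- z) = 1).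
  { rewrite <- Cexp_plus, <- Cexp_0; f_equal; ring. }
  rewrite H, Cmult_0_l in E; injection E; lra.
Qed.

(** The lower bound [1 + t <= exp t] at [t = - x] gives [exp x * (1 - x) <= 1], and [(1 + x + 2 x^2)
    (1 - x) = 1 + x^2 (1 - 2 x) >= 1] on the given range. *)
Lemma exp_sub_linear_le (x : R) : (Rabs x <= 1 / 2)%R -> (Rabs (exp x - 1 - x) <= 2 * x ^ 2)%R.
Proof.
  intros Hx; apply Rabs_le_between in Hx.
  pose proof (exp_ineq1_le x); pose proof (exp_ineq1_le (- x)).
  assert (E : (exp x * exp (- x) = 1)%R) by (rewrite <- exp_plus, <- exp_0; f_equal; ring).
  pose proof (exp_pos x).
  rewrite Rabs_pos_eq by lra.
  assert (exp x * (1 - x) <= 1)%R by nra.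
  assert (1 <= (1 + x + 2 * x ^ 2) * (1 - x))%R by nra.
  nra.
Qed.

Lemma cos_sub_one_le (y : R) : (Rabs (cos y - 1) <= y ^ 2)%R.
Proof.
  replace (cos y) with (1 - 2 * sin (y / 2) * sin (y / 2))%R
    by (rewrite <- cos_2a_sin; f_equal; field).
  assert (Hs : (Rabs (sin (y / 2)) <= Rabs (y / 2))%R).
  { destruct (MVT_gen sin 0 (y / 2) cos) as [c [_ Hc]].
    - intros; auto_derive; [trivial | ring].
    - intros; apply continuity_pt_filterlim; apply continuous_sin.
    - rewrite sin_0, !Rminus_0_r in Hc; rewrite Hc, Rabs_mult.
      pose proof (COS_bound c) as Hb.
      assert (Rabs (cos c) <= 1)%R by (apply Rabs_le; lra).
      pose proof (Rabs_pos (y / 2)); nra. }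
  apply Rsqr_le_abs_1 in Hs; unfold Rsqr in Hs.
  rewrite Rabs_left1; nra.
Qed.

Lemma sin_sub_id_le (y : R) : (Rabs y <= 1)%R -> (Rabs (sin y - y) <= y ^ 2)%R.
Proof.
  intros Hy.
  destruct (MVT_gen (fun t => sin t - t)%R 0 y (fun t => cos t - 1)%R) as [c [Hc E]].
  - intros; auto_derive; [trivial | ring].
  - intros; apply continuity_pt_minus; [apply continuity_sin | apply continuity_pt_id].
  - rewrite sin_0, !Rminus_0_r in E; rewrite E, Rabs_mult.
    pose proof (cos_sub_one_le c) as H1.
    assert (Hcy : (Rabs c <= Rabs y)%R).
    { unfold Rmin, Rmax in Hc; destruct (Rle_dec 0 y);
        unfold Rabs; destruct (Rcase_abs c), (Rcase_abs y); lra. }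
    rewrite <- (pow2_abs c) in H1; rewrite <- (pow2_abs y).
    pose proof (Rabs_pos c); pose proof (Rabs_pos y).
    assert (Rabs c ^ 2 <= Rabs y)%R by nra.
    nra.
Qed.

Lemma Cexp_sub_linear_le (k : C) :
  (Cmod k <= 1 / 2)%R -> (Cmod (Cexp k - 1 - k) <= 10 * Cmod k ^ 2)%R.
Proof.
  intros Hk.
  pose proof (re_le_Cmod k) as Hx; pose proof (im_le_Cmod k) as Hy.
  destruct k as [x y]; set (r := Cmod (x, y)) in *; simpl in Hx, Hy.
  pose proof (exp_sub_linear_le x ltac:(lra)) as H1.
  pose proof (cos_sub_one_le y) as H2.
  pose proof (sin_sub_id_le y ltac:(lra)) as H3.
  rewrite <- (pow2_abs x) in H1; rewrite <- (pow2_abs y) in H2, H3.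
  pose proof (Rabs_pos x) as Px; pose proof (Rabs_pos y) as Py.
  eapply Rle_trans; [apply Cmod_le_Rabs |]; unfold Cexp; simpl.
  (* Both parts are split so that every term is either a bounded factor times one of the three real
     remainders or the product [x * sin y], itself of second order. *)
  assert (Hre : (Rabs (exp x * cos y + - (1) + - x) <= 4 * r ^ 2)%R).
  { replace (exp x * cos y + - (1) + - x)%R
      with ((exp x - 1 - x) * cos y + (1 + x) * (cos y - 1))%R by ring.
    eapply Rle_trans; [apply Rabs_triang |]; rewrite !Rabs_mult.
    assert (Rabs (cos y) <= 1)%R by (pose proof (COS_bound y); apply Rabs_le; lra).
    assert (Rabs (1 + x) <= 2)%R.
    { eapply Rle_trans; [apply Rabs_triang |]; rewrite Rabs_R1; lra. }
    pose proof (Rabs_pos (exp x - 1 - x)); pose proof (Rabs_pos (cos y - 1)).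
    pose proof (Rabs_pos (cos y)); pose proof (Rabs_pos (1 + x)).
    nra. }
  assert (Him : (Rabs (exp x * sin y + - 0 + - y) <= 6 * r ^ 2)%R).
  { replace (exp x * sin y + - 0 + - y)%R
      with ((exp x - 1 - x) * sin y + x * sin y + (sin y - y))%R by ring.
    eapply Rle_trans; [apply Rabs_triang |].
    assert (Hs : (Rabs (sin y) <= 2 * r)%R).
    { replace (sin y) with ((sin y - y) + y)%R by ring.
      eapply Rle_trans; [apply Rabs_triang |]; nra. }
    pose proof (Rabs_triang ((exp x - 1 - x) * sin y) (x * sin y)) as Ht.
    rewrite !Rabs_mult in Ht.
    pose proof (Rabs_pos (sin y)); pose proof (Rabs_pos (exp x - 1 - x)).
    assert (Rabs (sin y) <= 1)%R by (pose proof (SIN_bound y); apply Rabs_le; lra).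
    assert (Rabs (exp x - 1 - x) * Rabs (sin y) <= 2 * r ^ 2)%R by nra.
    assert (Rabs x * Rabs (sin y) <= 2 * r ^ 2)%R by nra.
    nra. }
  lra.
Qed.

Lemma is_deriveC_Cexp (w : C) : is_deriveC Cexp w (Cexp w).
Proof.
  apply is_deriveC_quadratic with (d := (1 / 2)%R) (M := (Cmod (Cexp w) * 10)%R); [lra |].
  intros y Hy.
  replace (Cexp y - Cexp w - (y - w) * Cexp w) with (Cexp w * (Cexp (y - w) - 1 - (y - w))).
  - rewrite Cmod_mult, Rmult_assoc.
    apply Rmult_le_compat_l; [apply Cmod_ge_0 | apply Cexp_sub_linear_le; lra].
  - assert (E : Cexp y = Cexp w * Cexp (y - w)) by (rewrite <- Cexp_plus; f_equal; ring).
    rewrite E; ring.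
Qed.

Lemma log_branch_neq_0 (U : C -> Prop) (ell : C -> C) (z : C) :
  log_branch U ell -> U z -> z <> 0.
Proof. intros [_ H] Hz; rewrite <- (proj2 (H z Hz)); apply Cexp_neq_0. Qed.

(** Continuity suffices because [ell] is a right inverse of [Cexp] near [z], whose derivative at
    [ell z] is [Cexp (ell z) = z]. *)
Lemma is_deriveC_log_branch (U : C -> Prop) (ell : C -> C) (z : C) :
  log_branch U ell -> U z -> is_deriveC ell z (/ z).
Proof.
  intros [HU H] Hz; destruct (H z Hz) as [Hc He].
  apply is_deriveC_local_inverse with Cexp.
  - rewrite <- He; apply Cexp_neq_0.
  - apply (filter_imp U); [intros y Hy; apply H; assumption | apply HU; assumption].
  - assumption.
  - rewrite <- He at 2; apply is_deriveC_Cexp.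
Qed.

Lemma is_deriveC_power_branch (U : C -> Prop) (ell : C -> C) (c z : C) :
  log_branch U ell -> U z ->
  is_deriveC (power_branch ell c) z (c / z * power_branch ell c z).
Proof.
  intros HU Hz; unfold power_branch.
  apply is_deriveC_comp with (f := Cexp) (g := fun y => c * ell y); [apply is_deriveC_Cexp |].
  replace (c / z) with (RtoC 0 * ell z + c * / z) by (unfold Cdiv; ring).
  apply is_deriveC_mult with (f := fun _ => c); [apply is_deriveC_const |].
  apply is_deriveC_log_branch with U; assumption.
Qed.
(** Each derivative of [z^b g] is again [z^b] times an explicit expression, so the power cancels and
    the result no longer involves the branch. The derivatives of [g] are parameters, so that [g] can
    be a series in [z] or in [/ z]. *)
Lemma Lop_power_branch (n lambda mu b : C) (U : C -> Prop) (ell g g1 g2 : C -> C) :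
  log_branch U ell ->
  (forall z, U z -> is_deriveC g z (g1 z)) ->
  (forall z, U z -> is_deriveC g1 z (g2 z)) ->
  let E := fun z => power_branch ell b z * g z in
  twice_derivable_on U E /\
  forall z, U z ->
    power_branch ell (- b) z * Lop n lambda mu E z
    = z ^ 2 * (g2 z + 2 * b / z * g1 z + b * (b - 1) / z ^ 2 * g z)
      + (n * z + mu * (1 - z ^ 2)) * (g1 z + b / z * g z)
      + (lambda - mu * n * z) * g z.
Proof.
  intros HU Hg Hg1 E.
  set (P := power_branch ell b) in *.
  set (E1 := fun z => P z * (g1 z + b / z * g z)).
  set (E2 := fun z => P z * (g2 z + 2 * b / z * g1 z + b * (b - 1) / z ^ 2 * g z)).
  assert (HE : forall z, U z -> is_deriveC E z (E1 z)).
  { intros z Hz; unfold E, E1.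
    replace (P z * (g1 z + b / z * g z)) with (b / z * P z * g z + P z * g1 z) by ring.
    apply is_deriveC_mult; [apply is_deriveC_power_branch with U | apply Hg]; assumption. }
  assert (HE1 : forall z, U z -> is_deriveC E1 z (E2 z)).
  { intros z Hz; unfold E1, E2.
    pose proof (log_branch_neq_0 U ell z HU Hz) as Hz0.
    replace (P z * (g2 z + 2 * b / z * g1 z + b * (b - 1) / z ^ 2 * g z))
      with (b / z * P z * (g1 z + b / z * g z)
            + P z * (g2 z + ((RtoC 0 * / z + b * - / z ^ 2) * g z + b / z * g1 z)))
      by (field; assumption).
    apply is_deriveC_mult with (f := P) (g := fun z => g1 z + b / z * g z);
      [apply is_deriveC_power_branch with U; assumption |].
    apply is_deriveC_plus with (f := g1) (g := fun z => b / z * g z); [apply Hg1; assumption |].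
    apply is_deriveC_mult with (f := fun z => b / z) (g := g); [| apply Hg; assumption].
    apply is_deriveC_mult with (f := fun _ => b) (g := Cinv);
      [apply is_deriveC_const | apply is_deriveC_inv; assumption]. }
  assert (HE' : forall z, U z -> is_deriveC (C_derive E) z (E2 z)).
  (* [C_derive E] is known to equal [E1] only on [U]; openness of [U] makes this an equality near
     [z], which is what a second derivative requires. *)
  { intros z Hz; apply (is_derive_ext_loc (K := C_AbsRing) (V := C_NormedModule) E1);
      [| apply HE1; assumption].
    apply locally_C, (filter_imp U); [| apply HU; assumption].
    intros y Hy; symmetry; apply is_C_derive_unique, HE; assumption. }
  split.
  - intros z Hz; split; eexists; [apply HE | apply HE']; assumption.
  - intros z Hz; unfold Lop.
    rewrite (is_C_derive_unique _ _ _ (HE' z Hz)), (is_C_derive_unique _ _ _ (HE z Hz)).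
    assert (HP : power_branch ell (- b) z * P z = 1).
    { unfold P, power_branch; rewrite <- Cexp_plus, <- Cexp_0; f_equal; ring. }
    unfold E, E1, E2; set (Q := power_branch ell (- b) z) in *.
    set (A := g2 z + _ + _); set (B := g1 z + _).
    transitivity (Q * P z * (z ^ 2 * A + (n * z + mu * (1 - z ^ 2)) * B
                             + (lambda - mu * n * z) * g z)); [ring |].
    rewrite HP; ring.
Qed.

(** * Entire power series *)

Lemma is_seriesC_unique (u : nat -> C) (l l' : C) :
  is_seriesC u l -> is_seriesC u l' -> l = l'.
Proof.
  intros H H'; apply (filterlim_locally_unique (V := C_NormedModule) (sum_n u) l l' H H').
Qed.

Lemma sumC_unique (u : nat -> C) (l : C) : is_seriesC u l -> sumC u = l.
Proof.
  intros H; unfold sumC; apply (iota_unique (V := C_CompleteNormedModule));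
    [intros y Hy; apply is_seriesC_unique with u |]; assumption.
Qed.

Lemma Cmod_series_le (u : nat -> C) (v : nat -> R) (l : C) (L : R) :
  (forall j, (Cmod (u j) <= v j)%R) -> is_seriesC u l -> is_series v L -> (Cmod l <= L)%R.
Proof.
  intros Huv Hu Hv.
  apply (is_lim_seq_le (fun N => Cmod (sum_n (G := C_AbelianGroup) u N)) (sum_n v) (Cmod l) L).
  - intros N; eapply Rle_trans; [apply (norm_sum_n_m (V := C_NormedModule)) |].
    apply sum_n_m_le; exact Huv.
  - apply (filterlim_comp _ _ _ _ (@norm _ C_NormedModule) _ _ _ Hu).
    apply (filterlim_norm (V := C_NormedModule)).
  - exact Hv.
Qed.

(* Stated as absolute convergence on every circle: such power series have
   infinite radius of convergence. *)
Definition entire_coef (c : nat -> C) : Prop :=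
  forall r : R, (0 < r)%R -> ex_series (fun j => Cmod (c j) * r ^ j)%R.

Definition psum (c : nat -> C) (z : C) : C := sumC (fun j => c j * z ^ j).

Definition shift (c : nat -> C) (j : nat) : C :=
  match j with O => RtoC 0 | S j' => c j' end.

Definition dcoef (c : nat -> C) (j : nat) : C := INR (S j) * c (S j).

Lemma ex_series_entire (c : nat -> C) (z : C) :
  entire_coef c -> ex_seriesC (fun j => c j * z ^ j).
Proof.
  intros Hc; unfold ex_seriesC.
  apply (ex_series_le (K := C_AbsRing) (V := C_CompleteNormedModule))
    with (b := fun j => (Cmod (c j) * (Cmod z + 1) ^ j)%R).
  - intros j; change (Cmod (c j * z ^ j) <= Cmod (c j) * (Cmod z + 1) ^ j)%R.
    rewrite Cmod_mult, Cmod_pow; apply Rmult_le_compat_l; [apply Cmod_ge_0 |].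
    pose proof (Cmod_ge_0 z); apply pow_incr; lra.
  - apply Hc; pose proof (Cmod_ge_0 z); lra.
Qed.

Lemma is_series_psum (c : nat -> C) (z : C) :
  entire_coef c -> is_seriesC (fun j => c j * z ^ j) (psum c z).
Proof.
  intros Hc; destruct (ex_series_entire c z Hc) as [l Hl].
  unfold psum; rewrite (sumC_unique _ _ Hl); exact Hl.
Qed.

Lemma is_series_shift (c : nat -> C) (z l : C) :
  is_seriesC (fun j => c j * z ^ j) l -> is_seriesC (fun j => shift c j * z ^ j) (z * l).
Proof.
  intros H; apply (is_series_decr_1 (K := C_AbsRing) (V := C_NormedModule)).
  apply (is_series_scal (K := C_AbsRing) (V := C_NormedModule) z) in H.
  replace (plus _ _) with (@scal C_AbsRing C_NormedModule z l).
  - apply is_series_ext with (2 := H).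
    intros j; change (z * (c j * z ^ j) = c j * (z * z ^ j)); ring.
  - change (z * l = z * l + - (0 * 1)); ring.
Qed.

Lemma INR_le_pow2 (j : nat) : (INR j <= 2 ^ j)%R.
Proof.
  induction j as [| j IH]; [simpl; lra |].
  rewrite S_INR; simpl; pose proof (pow_R1_Rle 2 j ltac:(lra)); lra.
Qed.

(** The factor [INR (S j)] is at most [2 ^ S j] and is absorbed by doubling the radius; [r + 1]
    replaces [r] so that passing from exponent [j] to [S j] only enlarges the bound. *)
Lemma entire_dcoef (c : nat -> C) : entire_coef c -> entire_coef (dcoef c).
Proof.
  intros Hc r Hr.
  assert (H : ex_series (fun j => Cmod (c (S j)) * (2 * (r + 1)) ^ S j)%R).
  { apply (ex_series_incr_1 (fun j => Cmod (c j) * (2 * (r + 1)) ^ j)%R), Hc; lra. }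
  apply (ex_series_le (K := R_AbsRing) (V := R_CompleteNormedModule)) with (2 := H).
  intros j; change (Rabs (Cmod (dcoef c j) * r ^ j) <= Cmod (c (S j)) * (2 * (r + 1)) ^ S j)%R.
  pose proof (Cmod_ge_0 (c (S j))) as H0.
  pose proof (pow_lt r j Hr) as Hp.
  rewrite Rabs_pos_eq by (apply Rmult_le_pos; [apply Cmod_ge_0 | lra]).
  unfold dcoef; rewrite Cmod_mult, Cmod_R, Rabs_pos_eq by apply pos_INR.
  rewrite Rpow_mult_distr.
  replace (INR (S j) * Cmod (c (S j)) * r ^ j)%R with (Cmod (c (S j)) * (INR (S j) * r ^ j))%R
    by ring.
  apply Rmult_le_compat_l; [assumption |].
  apply Rmult_le_compat; [apply pos_INR | lra | apply INR_le_pow2 |].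
  apply Rle_trans with ((r + 1) ^ j)%R; [apply pow_incr; lra |].
  apply Rle_pow; [lra | lia].
Qed.

(** The derived series is kept in the indexing of [c], with a vanishing term at 0, so that it can be
    subtracted term by term from the series at two points. *)
Lemma is_series_dcoef (c : nat -> C) (z : C) :
  entire_coef c ->
  is_seriesC (fun j => c j * (INR j * z ^ Nat.pred j)) (psum (dcoef c) z).
Proof.
  intros Hc; apply (is_series_decr_1 (K := C_AbsRing) (V := C_NormedModule)).
  replace (plus _ _) with (psum (dcoef c) z).
  - apply is_series_ext with (2 := is_series_psum _ z (entire_dcoef c Hc)).
    intros j; unfold dcoef.
    change (INR (S j) * c (S j) * z ^ j = c (S j) * (INR (S j) * z ^ j)); ring.
  - change (psum (dcoef c) z = psum (dcoef c) z + - (c O * (0 * 1))); ring.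
Qed.

(** The remainder at [S j] is [y] times the remainder at [j] plus [(y - z)^2 j z^(j-1)], and
    [j^2 + j <= (j + 1)^2]. Since [rho >= 1], lower powers of [rho] may be replaced by [rho ^ j]. *)
Lemma pow_taylor1_le (y z : C) (rho : R) (j : nat) :
  (1 <= rho)%R -> (Cmod z <= rho)%R -> (Cmod y <= rho)%R ->
  (Cmod (y ^ j - z ^ j - (y - z) * (INR j * z ^ Nat.pred j))
   <= INR j ^ 2 * (Cmod (y - z) ^ 2 * rho ^ j))%R.
Proof.
  intros Hrho Hz Hy; induction j as [| j IH].
  - simpl; replace (1 - 1 - (y - z) * (0 * 1)) with (RtoC 0) by ring.
    rewrite Cmod_0; lra.
  - replace (y ^ S j - z ^ S j - (y - z) * (INR (S j) * z ^ Nat.pred (S j)))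
      with (y * (y ^ j - z ^ j - (y - z) * (INR j * z ^ Nat.pred j))
            + (y - z) ^ 2 * (INR j * z ^ Nat.pred j)).
    2:{ rewrite S_INR, RtoC_plus; destruct j as [| j]; simpl Nat.pred.
        - simpl; ring.
        - rewrite !Cpow_S; ring. }
    eapply Rle_trans; [apply Cmod_triangle |].
    rewrite !Cmod_mult, !Cmod_pow, Cmod_R, Rabs_pos_eq by apply pos_INR.
    set (h2 := (Cmod (y - z) ^ 2)%R) in *.
    assert (Hh : (0 <= h2)%R) by apply pow2_ge_0.
    assert (Hp : (0 <= rho ^ j)%R) by (apply pow_le; lra).
    assert (Hzp : (Cmod z ^ Nat.pred j <= rho * rho ^ j)%R).
    { apply Rle_trans with (rho ^ Nat.pred j)%R;
        [apply pow_incr; split; [apply Cmod_ge_0 | assumption] |].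
      change (rho * rho ^ j)%R with (rho ^ S j)%R; apply Rle_pow; [assumption | lia]. }
    pose proof (pos_INR j) as Hj; rewrite S_INR; change (rho ^ S j)%R with (rho * rho ^ j)%R.
    apply Rle_trans with
      (rho * (INR j ^ 2 * (h2 * rho ^ j)) + h2 * (INR j * (rho * rho ^ j)))%R.
    + apply Rplus_le_compat.
      * apply Rmult_le_compat; [apply Cmod_ge_0 | apply Cmod_ge_0 | assumption | exact IH].
      * apply Rmult_le_compat_l, Rmult_le_compat_l; assumption.
    + replace (rho * (INR j ^ 2 * (h2 * rho ^ j)) + h2 * (INR j * (rho * rho ^ j)))%R
        with ((INR j ^ 2 + INR j) * (h2 * (rho * rho ^ j)))%R by ring.
      apply Rmult_le_compat_r; [| simpl; nra].
      apply Rmult_le_pos; [assumption | apply Rmult_le_pos; lra].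
Qed.

Lemma is_deriveC_psum (c : nat -> C) (z : C) :
  entire_coef c -> is_deriveC (psum c) z (psum (dcoef c) z).
Proof.
  intros Hc; pose proof (Cmod_ge_0 z) as Hz0.
  set (rho := (Cmod z + 1)%R).
  (* The factor 4 pays for the [INR j ^ 2] of the Taylor bound, as [INR j ^ 2 <= 4 ^ j]; the sum at
     this radius is the constant of the quadratic remainder. *)
  assert (Hex := Hc (4 * rho)%R ltac:(unfold rho; lra)).
  destruct Hex as [M HM].
  apply is_deriveC_quadratic with (d := 1%R) (M := M); [lra |].
  intros y Hy.
  assert (Hyr : (Cmod y <= rho)%R).
  { replace y with ((y - z) + z) by ring.
    eapply Rle_trans; [apply Cmod_triangle | unfold rho; lra]. }
  pose proof (is_series_scal (K := C_AbsRing) (V := C_NormedModule) (y - z) _ _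
                (is_series_dcoef c z Hc)) as Hd.
  pose proof (is_series_minus (K := C_AbsRing) (V := C_NormedModule) _ _ _ _
                (is_series_minus (K := C_AbsRing) (V := C_NormedModule) _ _ _ _
                   (is_series_psum c y Hc) (is_series_psum c z Hc)) Hd) as H.
  refine (Cmod_series_le _ (fun j => Cmod (c j) * (4 * rho) ^ j * Cmod (y - z) ^ 2)%R _
            (M * Cmod (y - z) ^ 2)%R _ H (is_series_scal_r _ _ _ HM)).
  intros j.
  change (Cmod (c j * y ^ j + - (c j * z ^ j)
                + - ((y - z) * (c j * (INR j * z ^ Nat.pred j))))
          <= Cmod (c j) * (4 * rho) ^ j * Cmod (y - z) ^ 2)%R.
  replace (_ + _ + _)
    with (c j * (y ^ j - z ^ j - (y - z) * (INR j * z ^ Nat.pred j))) by ring.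
  rewrite Cmod_mult, Rmult_assoc; apply Rmult_le_compat_l; [apply Cmod_ge_0 |].
  eapply Rle_trans; [apply (pow_taylor1_le y z rho); unfold rho in *; lra |].
  rewrite Rpow_mult_distr.
  replace (4 ^ j * rho ^ j * Cmod (y - z) ^ 2)%R
    with (4 ^ j * (Cmod (y - z) ^ 2 * rho ^ j))%R by ring.
  apply Rmult_le_compat_r.
  - apply Rmult_le_pos; [apply pow2_ge_0 | apply pow_le; unfold rho; lra].
  - replace 4%R with (2 * 2)%R by ring; rewrite Rpow_mult_distr.
    pose proof (INR_le_pow2 j); pose proof (pos_INR j); simpl; nra.
Qed.

Lemma is_series_affine_coef (c : nat -> C) (p z : C) :
  entire_coef c ->
  is_seriesC (fun j => (INR j + p) * c j * z ^ j) (z * psum (dcoef c) z + p * psum c z).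
Proof.
  intros Hc.
  pose proof (is_series_shift _ z _ (is_series_psum _ z (entire_dcoef c Hc))) as H1.
  pose proof (is_series_scal (K := C_AbsRing) (V := C_NormedModule) p _ _
                (is_series_psum c z Hc)) as H0.
  apply is_series_ext
    with (2 := is_series_plus (K := C_AbsRing) (V := C_NormedModule) _ _ _ _ H1 H0).
  intros j; change (shift (dcoef c) j * z ^ j + p * (c j * z ^ j) = (INR j + p) * c j * z ^ j).
  destruct j as [| j]; unfold shift, dcoef; [change (INR 0) with 0%R |]; ring.
Qed.

(** Second derivatives produce [j (j - 1)], and [(j + p) (j + q) = j (j - 1) + (p + q + 1) j + p
    q]. *)
Lemma is_series_quadratic_coef (c : nat -> C) (p q l z : C) :
  entire_coef c ->
  is_seriesC (fun j => ((INR j + p) * (INR j + q) + l) * c j * z ^ j)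
    (z ^ 2 * psum (dcoef (dcoef c)) z + (p + q + 1) * (z * psum (dcoef c) z)
     + (p * q + l) * psum c z).
Proof.
  intros Hc.
  pose proof (is_series_shift _ z _ (is_series_shift _ z _
                (is_series_psum _ z (entire_dcoef _ (entire_dcoef c Hc))))) as H2.
  pose proof (is_series_scal (K := C_AbsRing) (V := C_NormedModule) (p + q + 1) _ _
                (is_series_shift _ z _ (is_series_psum _ z (entire_dcoef c Hc)))) as H1.
  pose proof (is_series_scal (K := C_AbsRing) (V := C_NormedModule) (p * q + l) _ _
                (is_series_psum c z Hc)) as H0.
  replace (z ^ 2 * psum (dcoef (dcoef c)) z) with (z * (z * psum (dcoef (dcoef c)) z)) by ring.
  apply is_series_ext
    with (2 := is_series_plus (K := C_AbsRing) (V := C_NormedModule) _ _ _ _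
                 (is_series_plus (K := C_AbsRing) (V := C_NormedModule) _ _ _ _ H2 H1) H0).
  intros j.
  change (shift (shift (dcoef (dcoef c))) j * z ^ j
          + (p + q + 1) * (shift (dcoef c) j * z ^ j) + (p * q + l) * (c j * z ^ j)
          = ((INR j + p) * (INR j + q) + l) * c j * z ^ j).
  destruct j as [| [| j]]; unfold shift, dcoef.
  - change (INR 0) with 0%R; ring.
  - change (INR 1) with 1%R; ring.
  - rewrite !S_INR, !RtoC_plus; ring.
Qed.

(* Multiplying the power series by its Euler-type operators produces a series
   whose coefficients from degree 3 on are the left-hand sides of the recurrence. *)
Lemma psum_three_term (c : nat -> C) (p q l mu x y e0 e1 e2 z : C) :
  entire_coef c ->
  mu * x * c 0%nat = e0 ->
  (p * q + l) * c 0%nat + mu * (1 + x) * c 1%nat = e1 ->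
  ((1 + p) * (1 + q) + l) * c 1%nat + mu * (2 + x) * c 2%nat - mu * y * c 0%nat = e2 ->
  (forall j : nat,
     ((INR j + 2 + p) * (INR j + 2 + q) + l) * c (S (S j))
     + mu * (INR j + 3 + x) * c (S (S (S j))) - mu * (INR j + 1 + y) * c (S j) = 0) ->
  z * (z ^ 2 * psum (dcoef (dcoef c)) z + (p + q + 1) * (z * psum (dcoef c) z)
       + (p * q + l) * psum c z)
  + mu * (z * psum (dcoef c) z + x * psum c z)
  - mu * z ^ 2 * (z * psum (dcoef c) z + y * psum c z)
  = e0 + e1 * z + e2 * z ^ 2.
Proof.
  intros Hc H0 H1 H2 Hrec.
  (* Multiplication by [z] keeps the lowering term in nonnegative degrees: one, zero and two shifts
     align the diagonal, lowering and raising terms. *)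
  pose proof (is_series_shift _ z _ (is_series_quadratic_coef c p q l z Hc)) as SA.
  pose proof (is_series_scal (K := C_AbsRing) (V := C_NormedModule) mu _ _
                (is_series_affine_coef c x z Hc)) as SB.
  pose proof (is_series_scal (K := C_AbsRing) (V := C_NormedModule) (- mu) _ _
                (is_series_shift _ z _ (is_series_shift _ z _
                   (is_series_affine_coef c y z Hc)))) as SD.
  pose proof (is_series_plus (K := C_AbsRing) (V := C_NormedModule) _ _ _ _
                (is_series_plus (K := C_AbsRing) (V := C_NormedModule) _ _ _ _ SA SB) SD) as HS.
  match type of HS with is_series ?u ?v => set (a := u) in HS; set (sum := v) in HS end.
  assert (E0 : a 0%nat = e0).
  { unfold a; change (0 * 1 + mu * ((0 + x) * c 0%nat * 1) + - mu * (0 * 1) = e0).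
    rewrite <- H0; ring. }
  assert (E1 : a 1%nat = e1 * z).
  { unfold a.
    change (((0 + p) * (0 + q) + l) * c 0%nat * (z * 1)
            + mu * ((1 + x) * c 1%nat * (z * 1)) + - mu * (0 * (z * 1)) = e1 * z).
    rewrite <- H1; ring. }
  assert (E2 : a 2%nat = e2 * z ^ 2).
  { unfold a.
    change (((1 + p) * (1 + q) + l) * c 1%nat * z ^ 2
            + mu * ((INR 2 + x) * c 2%nat * z ^ 2)
            + - mu * ((0 + y) * c 0%nat * z ^ 2) = e2 * z ^ 2).
    rewrite <- H2; change (INR 2) with (1 + 1)%R; rewrite RtoC_plus; ring. }
  assert (E3 : forall j, a (3 + j)%nat = RtoC 0).
  { intros j; unfold a.
    change (((INR (2 + j) + p) * (INR (2 + j) + q) + l) * c (2 + j)%nat * z ^ (3 + j)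
            + mu * ((INR (3 + j) + x) * c (3 + j)%nat * z ^ (3 + j))
            + - mu * ((INR (1 + j) + y) * c (1 + j)%nat * z ^ (3 + j)) = 0).
    rewrite !plus_INR, !RtoC_plus; change (INR 1) with 1%R.
    replace (INR 2) with 2%R by (simpl; ring); replace (INR 3) with 3%R by (simpl; ring).
    transitivity (z ^ (3 + j) * (((INR j + 2 + p) * (INR j + 2 + q) + l) * c (S (S j))
      + mu * (INR j + 3 + x) * c (S (S (S j))) - mu * (INR j + 1 + y) * c (S j)));
      [simpl Nat.add; ring | rewrite Hrec; ring]. }
  assert (HS' : is_seriesC a (e0 + e1 * z + e2 * z ^ 2)).
  { apply (is_series_decr_n (K := C_AbsRing) (V := C_NormedModule) a 3); [lia |].
    simpl Init.Nat.pred; rewrite !sum_Sn, sum_O, E0, E1, E2.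
    match goal with |- is_series _ ?v => replace v with (RtoC 0) end.
    2:{ change (RtoC 0 = e0 + e1 * z + e2 * z ^ 2 + - (e0 + e1 * z + e2 * z ^ 2)); ring. }
    apply is_series_ext with (fun _ => RtoC 0); [intros; symmetry; apply E3 |].
    apply filterlim_ext with (fun _ => RtoC 0); [| apply filterlim_const].
    intros N; symmetry; apply (sum_n_m_const_zero (G := C_AbelianGroup)). }
  rewrite <- (is_seriesC_unique _ _ _ HS HS').
  unfold sum; change plus with Cplus; change scal with Cmult; ring.
Qed.

(** * Infinite products of companion matrices *)

(** Both [Mmat] and [Smat] are convertible to this shape, so convergence, bounds and recurrence are
    established once. *)
Definition companion (alpha beta : nat -> C) (k : nat) : mat2 :=
  [[ 1 + alpha k, beta k ], [ RtoC 1, RtoC 0 ]].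

Lemma entry_companion (alpha beta : nat -> C) (k : nat) :
  entry (companion alpha beta k) 0 0 = 1 + alpha k /\
  entry (companion alpha beta k) 0 1 = beta k /\
  entry (companion alpha beta k) 1 0 = 1 /\
  entry (companion alpha beta k) 1 1 = 0.
Proof. repeat split. Qed.

Lemma entry_Mmult (A B : mat2) (i j : nat) :
  (i < 2)%nat -> (j < 2)%nat ->
  entry (@Mmult C_Ring 2 2 2 A B) i j
  = entry A i 0 * entry B 0 j + entry A i 1 * entry B 1 j.
Proof.
  intros Hi Hj; unfold entry, Mmult; rewrite coeff_mat_bij by assumption.
  simpl Init.Nat.pred; rewrite sum_Sn, sum_O; reflexivity.
Qed.

(** Partial products grow on the right, which suits the estimates; the recurrence needs a factor
    taken off on the left. *)
Lemma matprod_S_l (M : nat -> mat2) (k N : nat) :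
  matprod M k (S N) = @Mmult C_Ring 2 2 2 (M k) (matprod M (S k) N).
Proof.
  induction N as [| N IH].
  - simpl; rewrite Mmult_one_l, Mmult_one_r, Nat.add_0_r; reflexivity.
  - change (matprod M k (S (S N)))
      with (@Mmult C_Ring 2 2 2 (matprod M k (S N)) (M (k + S N)%nat)).
    rewrite IH, <- Mmult_assoc, Nat.add_succ_r; reflexivity.
Qed.

Lemma matprod_companion_S (alpha beta : nat -> C) (k N i : nat) :
  (i < 2)%nat ->
  let P := matprod (companion alpha beta) k in
  entry (P (S N)) i 0 = entry (P N) i 0 * (1 + alpha (k + N)%nat) + entry (P N) i 1 /\
  entry (P (S N)) i 1 = entry (P N) i 0 * beta (k + N)%nat.
Proof.
  intros Hi P; unfold P; simpl matprod; rewrite !entry_Mmult by lia.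
  destruct (entry_companion alpha beta (k + N)) as [-> [-> [-> ->]]].
  split; ring.
Qed.

Lemma exp_le_mono (x y : R) : (x <= y)%R -> (exp x <= exp y)%R.
Proof. intros [H | ->]; [left; apply exp_increasing, H | right; reflexivity]. Qed.

Lemma geometric_growth_bound (w eps : nat -> R) :
  (forall N, 0 <= w N)%R -> (forall N, 0 <= eps N)%R ->
  (forall N, w (S N) <= (1 + eps N) * w N)%R -> ex_series eps ->
  forall N, (w N <= w 0%nat * exp (Series eps))%R.
Proof.
  intros Hw He Hs Hex.
  assert (Hsum : forall N, (sum_n eps N <= Series eps)%R).
  { intros N; apply (is_lim_seq_incr_compare (sum_n eps)).
    - exact (Series_correct _ Hex).
    - intros m; rewrite sum_Sn; unfold plus; simpl; specialize (He (S m)); lra. }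
  (* [sum_n eps N] includes the index [N], so it matches [w (S N)], and [w 0] is treated apart. *)
  assert (H : forall N, (w (S N) <= w 0%nat * exp (sum_n eps N))%R).
  { induction N as [| N IH].
    - rewrite sum_O; eapply Rle_trans; [apply Hs |].
      rewrite Rmult_comm; apply Rmult_le_compat_l; [apply Hw | apply exp_ineq1_le].
    - rewrite sum_Sn; unfold plus; simpl; rewrite exp_plus.
      eapply Rle_trans; [apply Hs |].
      pose proof (exp_ineq1_le (eps (S N))); specialize (He (S N)); specialize (Hw (S N)).
      rewrite <- Rmult_assoc, (Rmult_comm (1 + _)).
      apply Rmult_le_compat; lra. }
  pose proof (Hw 0%nat) as H0.
  intros [| N].
  - rewrite <- (Rmult_1_r (w 0%nat)) at 1; apply Rmult_le_compat_l; [assumption |].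
    rewrite <- exp_0; apply exp_le_mono.
    eapply Rle_trans; [apply (He 0%nat) |]; rewrite <- (sum_O eps); apply Hsum.
  - eapply Rle_trans; [apply H |].
    apply Rmult_le_compat_l; [assumption | apply exp_le_mono, Hsum].
Qed.

(** * Limits of complex sequences *)

Lemma limC_unique (u : nat -> C) (l : C) : is_limC u l -> limC u = l.
Proof.
  intros H; unfold limC, is_limC; apply (iota_filterlim_locally (V := C_CompleteNormedModule)), H.
Qed.

Lemma is_limC_unique (u : nat -> C) (l l' : C) : is_limC u l -> is_limC u l' -> l = l'.
Proof. intros H H'; rewrite <- (limC_unique u l H); apply limC_unique, H'. Qed.

Lemma is_limC_plus (u v : nat -> C) (l m : C) :
  is_limC u l -> is_limC v m -> is_limC (fun N => u N + v N) (l + m).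
Proof.
  intros Hu Hv; eapply (filterlim_comp_2 (H := locally (m : C_NormedModule)) u v
                          (@plus C_NormedModule)); [exact Hu | exact Hv |].
  apply (filterlim_plus (V := C_NormedModule)).
Qed.

Lemma is_limC_scal (u : nat -> C) (c l : C) :
  is_limC u l -> is_limC (fun N => c * u N) (c * l).
Proof.
  intros Hu; apply (filterlim_comp _ _ _ _ (@scal C_AbsRing C_NormedModule c) _ _ _ Hu).
  apply (filterlim_scal_r (V := C_NormedModule)).
Qed.

Lemma is_limC_incr_1 (u : nat -> C) (l : C) :
  is_limC (fun N => u (S N)) l <-> is_limC u l.
Proof.
  split; intros H P HP.
  - destruct (H P HP) as [N HN]; exists (S N); intros [| j] Hj; [lia | apply HN; lia].
  - destruct (H P HP) as [N HN]; exists N; intros j Hj; apply HN; lia.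
Qed.

Lemma is_limC_0 (u : nat -> C) (v : nat -> R) :
  (forall N, Cmod (u N) <= v N)%R -> is_lim_seq v 0 -> is_limC u 0.
Proof.
  intros Huv Hv; apply (filterlim_norm_zero (V := C_NormedModule)).
  apply (is_lim_seq_le_le (fun _ => 0%R) (fun N => Cmod (u N)) v 0).
  - intros N; split; [apply Cmod_ge_0 | apply Huv].
  - apply is_lim_seq_const.
  - exact Hv.
Qed.

Lemma is_limC_Cmod_le (u : nat -> C) (l : C) (B : R) :
  is_limC u l -> (forall N, Cmod (u N) <= B)%R -> (Cmod l <= B)%R.
Proof.
  intros H HB.
  apply (is_lim_seq_le (fun N => Cmod (u N)) (fun _ => B) (Cmod l) B HB);
    [| apply is_lim_seq_const].
  apply (filterlim_comp _ _ _ _ (@norm _ C_NormedModule) _ _ _ H).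
  apply (filterlim_norm (V := C_NormedModule)).
Qed.

Lemma ex_limC_summable_increments (u : nat -> C) (v : nat -> R) :
  (forall N, Cmod (u (S N) - u N) <= v N)%R -> ex_series v -> exists l, is_limC u l.
Proof.
  intros Huv Hv.
  destruct (ex_series_le (K := C_AbsRing) (V := C_CompleteNormedModule)
              (fun N => u (S N) - u N) v Huv Hv) as [l Hl].
  exists (u 0%nat + l); apply is_limC_incr_1.
  apply (filterlim_ext (fun N => u 0%nat + sum_n (G := C_AbelianGroup) (fun N => u (S N) - u N) N)).
  - induction x as [| N IH].
    + rewrite sum_O; ring.
    + rewrite sum_Sn; change plus with Cplus.
      rewrite Cplus_assoc, IH; ring.
  - apply is_limC_plus; [apply filterlim_const | exact Hl].
Qed.

Section CompanionProduct.

Variables alpha beta : nat -> C.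
Hypothesis Ha : ex_series (fun k => Cmod (alpha k)).
Hypothesis Hb : ex_series (fun k => Cmod (beta k)).

Let eps (k : nat) : R := (Cmod (alpha k) + Cmod (beta k))%R.
(** Summing from index 0 yields one constant for the products from every starting index. *)
Let B : R := exp (Series eps).

Let eps_ge_0 (k : nat) : (0 <= eps k)%R.
Proof. apply Rplus_le_le_0_compat; apply Cmod_ge_0. Qed.

Let ex_series_eps (k : nat) : ex_series (fun N => eps (k + N)%nat).
Proof.
  apply (ex_series_incr_n eps), (ex_series_plus (K := R_AbsRing) (V := R_NormedModule));
    assumption.
Qed.

Let Series_eps_le (k : nat) : (Series (fun N => eps (k + N)%nat) <= Series eps)%R.
Proof.
  destruct k as [| k]; [apply Req_le, Series_ext; reflexivity |].
  rewrite (Series_incr_n eps (S k)) by (lia || apply (ex_series_eps 0)).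
  assert (0 <= sum_f_R0 eps (Init.Nat.pred (S k)))%R by (apply cond_pos_sum, eps_ge_0).
  lra.
Qed.

(** The sum of moduli suits a row [(p, q)]: the limiting factor sends it to [(p + q, 0)], which does
    not increase this norm, and the perturbation adds at most [eps] times the norm. *)
Lemma matprod_companion_bound (k N i : nat) :
  (i < 2)%nat ->
  (Cmod (entry (matprod (companion alpha beta) k N) i 0)
   + Cmod (entry (matprod (companion alpha beta) k N) i 1) <= B)%R.
Proof.
  intros Hi; set (P := matprod (companion alpha beta) k).
  set (w := fun N => (Cmod (entry (P N) i 0) + Cmod (entry (P N) i 1))%R).
  assert (Hw0 : w 0%nat = 1%R).
  { unfold w, P; simpl matprod; unfold entry, Mone.
    rewrite !coeff_mat_bij by lia.
    destruct i as [| [| i]]; [| | lia]; simpl.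
    - change (Cmod 1 + Cmod 0 = 1)%R; rewrite Cmod_1, Cmod_0; ring.
    - change (Cmod 0 + Cmod 1 = 1)%R; rewrite Cmod_1, Cmod_0; ring. }
  pose proof (geometric_growth_bound w (fun N => eps (k + N)%nat)) as H.
  rewrite Hw0 in H.
  apply Rle_trans with (1 * exp (Series (fun N => eps (k + N)%nat)))%R.
  - apply H; clear H.
    + intros; apply Rplus_le_le_0_compat; apply Cmod_ge_0.
    + intros; apply eps_ge_0.
    + intros m; unfold w, P.
      destruct (matprod_companion_S alpha beta k m i Hi) as [-> ->]; fold P.
      eapply Rle_trans; [apply Rplus_le_compat_r, Cmod_triangle |].
      rewrite !Cmod_mult.
      pose proof (Cmod_triangle 1 (alpha (k + m)%nat)) as Ht; rewrite Cmod_1 in Ht.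
      pose proof (Cmod_ge_0 (entry (P m) i 0)); pose proof (Cmod_ge_0 (entry (P m) i 1)).
      pose proof (Cmod_ge_0 (alpha (k + m)%nat)); pose proof (Cmod_ge_0 (beta (k + m)%nat)).
      unfold eps; nra.
    + apply ex_series_eps.
  - rewrite Rmult_1_l; apply exp_le_mono, Series_eps_le.
Qed.

(* The row sum of the partial product changes by (alpha + beta) times its first
   entry, so it converges, while the second entry tends to 0. *)
Lemma ex_infprod_companion (k : nat) : ex_infprod (companion alpha beta) k.
Proof.
  intros i j Hi Hj; set (P := matprod (companion alpha beta) k).
  assert (Hbound : forall N, (Cmod (entry (P N) i 0) <= B)%R).
  { intros N; pose proof (matprod_companion_bound k N i Hi) as H; fold (P N) in H.
    pose proof (Cmod_ge_0 (entry (P N) i 1)); lra. }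
  assert (HBeps : ex_series (fun N => (B * eps (k + N)%nat)%R)).
  { apply (ex_series_scal (K := R_AbsRing) (V := R_NormedModule) B), ex_series_eps. }
  assert (H1 : is_limC (fun N => entry (P N) i 1) 0).
  { apply is_limC_incr_1, is_limC_0 with (fun N => (B * eps (k + N)%nat)%R);
      [| exact (ex_series_lim_0 _ HBeps)].
    intros N; unfold P; destruct (matprod_companion_S alpha beta k N i Hi) as [_ ->]; fold P.
    rewrite Cmod_mult; apply Rmult_le_compat; try apply Cmod_ge_0; [apply Hbound |].
    unfold eps; pose proof (Cmod_ge_0 (alpha (k + N)%nat)); lra. }
  destruct j as [| [| j]]; [| exists 0; exact H1 | lia].
  destruct (ex_limC_summable_increments (fun N => entry (P N) i 0 + entry (P N) i 1)
              (fun N => (B * eps (k + N)%nat)%R)) as [l Hl]; [| exact HBeps |].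
  - intros N; unfold P; destruct (matprod_companion_S alpha beta k N i Hi) as [-> ->]; fold P.
    replace (_ - _) with (entry (P N) i 0 * (alpha (k + N)%nat + beta (k + N)%nat)) by ring.
    rewrite Cmod_mult; apply Rmult_le_compat; try apply Cmod_ge_0;
      [apply Hbound | apply Cmod_triangle].
  - exists (l + - (1) * 0).
    apply filterlim_ext
      with (2 := is_limC_plus _ _ _ _ Hl (is_limC_scal _ (- (1)) _ H1)).
    intros N; ring.
Qed.

Lemma is_limC_infprod (k i j : nat) :
  (i < 2)%nat -> (j < 2)%nat ->
  is_limC (fun N => entry (matprod (companion alpha beta) k N) i j)
    (entry (infprod (companion alpha beta) k) i j).
Proof.
  intros Hi Hj; destruct (ex_infprod_companion k i j Hi Hj) as [l Hl].
  unfold infprod; unfold entry at 2; rewrite coeff_mat_bij by assumption.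
  rewrite (limC_unique _ _ Hl); exact Hl.
Qed.

Lemma infprod_companion_bound (k : nat) :
  (Cmod (entry (infprod (companion alpha beta) k) 1 0) <= B)%R.
Proof.
  apply (is_limC_Cmod_le _ _ _ (is_limC_infprod k 1 0 ltac:(lia) ltac:(lia))).
  intros N; pose proof (matprod_companion_bound k N 1 ltac:(lia)) as H.
  pose proof (Cmod_ge_0 (entry (matprod (companion alpha beta) k N) 1 1)); lra.
Qed.

Lemma infprod_companion_recurrence (k : nat) :
  let r := fun k => entry (infprod (companion alpha beta) k) 1 0 in
  r k = (1 + alpha (S k)) * r (S k) + beta (S k) * r (S (S k)).
Proof.
  intros r.
  assert (H10 : forall k, r k = entry (infprod (companion alpha beta) (S k)) 0 0).
  { intros m; apply is_limC_unique
      with (fun N => entry (matprod (companion alpha beta) m (S N)) 1 0).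
    - apply (is_limC_incr_1 (fun N => entry (matprod (companion alpha beta) m N) 1 0)).
      apply is_limC_infprod; lia.
    - apply filterlim_ext with (2 := is_limC_infprod (S m) 0 0 ltac:(lia) ltac:(lia)).
      intros N; rewrite matprod_S_l, entry_Mmult by lia.
      destruct (entry_companion alpha beta m) as [_ [_ [-> ->]]]; ring. }
  (* Only [r k] and [r (S k)] become upper left entries. The latter and [r (S (S k))] are then the
     first column of the same product, the one starting at [S (S k)]. *)
  rewrite H10, (H10 (S k)); unfold r.
  apply is_limC_unique
    with (fun N => entry (matprod (companion alpha beta) (S k) (S N)) 0 0).
  - apply (is_limC_incr_1 (fun N => entry (matprod (companion alpha beta) (S k) N) 0 0)).
    apply is_limC_infprod; lia.
  - apply filterlim_ext
      with (2 := is_limC_plus _ _ _ _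
        (is_limC_scal _ (1 + alpha (S k)) _
           (is_limC_infprod (S (S k)) 0 0 ltac:(lia) ltac:(lia)))
        (is_limC_scal _ (beta (S k)) _
           (is_limC_infprod (S (S k)) 1 0 ltac:(lia) ltac:(lia)))).
    intros N; rewrite matprod_S_l, entry_Mmult by lia.
    destruct (entry_companion alpha beta (S k)) as [-> [-> _]]; ring.
Qed.

End CompanionProduct.

(** * The coefficients *)

Lemma not_integer_plus (c : C) : not_integer c -> forall j : Z, c + IZR j <> 0.
Proof.
  intros Hc j H; apply (Hc (- j)%Z).
  rewrite opp_IZR, RtoC_opp.
  replace c with (c + IZR j - IZR j) by ring; rewrite H; ring.
Qed.

Ltac not_integer_shift H j :=
  let E := fresh in
  intros E; apply (not_integer_plus _ H j); rewrite <- E;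
  rewrite ?S_INR, ?INR_IZR_INZ, ?plus_IZR, ?minus_IZR, ?opp_IZR,
    ?RtoC_plus, ?RtoC_minus, ?RtoC_opp; ring.

Ltac nonzero_by H :=
  let E := fresh in
  intros E; apply H;
  first [ rewrite <- E; ring | replace (RtoC 0) with (- RtoC 0) by ring; rewrite <- E; ring ].

(** * Summability of the matrix entries *)

Lemma eventually_INR_ge (x : R) : eventually (fun k => (x <= INR k)%R).
Proof.
  destruct (nfloor_ex (Rmax 0 x) (Rmax_l _ _)) as [N [_ HN]].
  exists (S N); intros k Hk; apply le_INR in Hk; rewrite S_INR in Hk.
  pose proof (Rmax_r 0 x); lra.
Qed.

(** Comparison with [INR k + 2] avoids a zero denominator at [k = 0] and leads to a telescoping
    reference series. *)
Lemma Cmod_INR_plus_ge (p : C) :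
  eventually (fun k => ((INR k + 2) / 2 <= Cmod (INR k + p))%R).
Proof.
  apply (filter_imp (fun k => (2 * Cmod p + 2 <= INR k)%R)); [| apply eventually_INR_ge].
  intros k Hk.
  pose proof (Cmod_triangle (INR k + p) (- p)) as Ht.
  replace (INR k + p + - p) with (RtoC (INR k)) in Ht by ring.
  rewrite Cmod_opp, Cmod_R, Rabs_pos_eq in Ht by apply pos_INR; lra.
Qed.

Lemma Cmod_INR_plus_le (p : C) :
  eventually (fun k => (Cmod (INR k + p) <= 2 * (INR k + 2))%R).
Proof.
  apply (filter_imp (fun k => (Cmod p <= INR k)%R)); [| apply eventually_INR_ge].
  intros k Hk; pose proof (Cmod_triangle (INR k) p) as Ht.
  rewrite Cmod_R, Rabs_pos_eq in Ht by apply pos_INR; lra.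
Qed.

Lemma ex_series_inv_square : ex_series (fun k => / (INR k + 2) ^ 2)%R.
Proof.
  apply (ex_series_le (K := R_AbsRing) (V := R_CompleteNormedModule))
    with (b := fun k => (/ ((INR k + 1) * (INR k + 2)))%R).
  - intros k; pose proof (pos_INR k) as Hk.
    change (Rabs (/ (INR k + 2) ^ 2) <= / ((INR k + 1) * (INR k + 2)))%R.
    rewrite Rabs_pos_eq; [| left; apply Rinv_0_lt_compat; nra].
    apply Rinv_le_contravar; nra.
  - exists 1%R.
    change (is_lim_seq (sum_n (fun k => / ((INR k + 1) * (INR k + 2)))%R) 1%R).
    apply (is_lim_seq_ext (fun N => 1 - / (INR N + 2))%R).
    + induction n as [| N IH].
      * rewrite sum_O; simpl; field.
      * rewrite sum_Sn, <- IH; pose proof (pos_INR N).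
        change (1 - / (INR (S N) + 2)
                = 1 - / (INR N + 2) + / ((INR (S N) + 1) * (INR (S N) + 2)))%R.
        rewrite S_INR.
        field; lra.
    + replace (Finite 1) with (Finite (1 - 0)) by (f_equal; ring).
      apply (is_lim_seq_minus' (fun _ => 1%R)); [apply is_lim_seq_const |].
      apply (is_lim_seq_inv (fun N => INR N + 2)%R p_infty); [| discriminate].
      apply is_lim_seq_le_p_loc with INR; [| apply is_lim_seq_INR].
      exists 0%nat; intros; lra.
Qed.

Lemma ex_series_eventually_inv_square (u : nat -> C) (M : R) :
  eventually (fun k => (Cmod (u k) <= M * / (INR k + 2) ^ 2)%R) ->
  ex_series (fun k => Cmod (u k)).
Proof.
  intros [N HN]; apply (ex_series_incr_n (fun k => Cmod (u k)) N).
  apply (ex_series_le (K := R_AbsRing) (V := R_CompleteNormedModule))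
    with (b := fun k => (M * / (INR (N + k) + 2) ^ 2)%R).
  - intros k; change (Rabs (Cmod (u (N + k)%nat)) <= M * / (INR (N + k) + 2) ^ 2)%R.
    rewrite Rabs_pos_eq by apply Cmod_ge_0; apply HN; lia.
  - apply (ex_series_incr_n (fun k => M * / (INR k + 2) ^ 2)%R N).
    apply (ex_series_scal (K := R_AbsRing) (V := R_NormedModule) M), ex_series_inv_square.
Qed.

Lemma ex_series_inv_quadratic (c p q : C) :
  ex_series (fun k => Cmod (c / ((INR k + p) * (INR k + q)))).
Proof.
  apply ex_series_eventually_inv_square with (4 * Cmod c)%R.
  apply (filter_imp (fun k => ((INR k + 2) / 2 <= Cmod (INR k + p))%R
                              /\ ((INR k + 2) / 2 <= Cmod (INR k + q))%R));
    [| apply filter_and; apply Cmod_INR_plus_ge].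
  intros k [Hp Hq]; pose proof (pos_INR k) as Hk.
  rewrite Cmod_div.
  2:{ apply Cmult_neq_0; apply Cmod_gt_0; lra. }
  rewrite Cmod_mult, (Rmult_comm 4), Rmult_assoc.
  apply Rmult_le_compat_l; [apply Cmod_ge_0 |].
  replace (4 * / (INR k + 2) ^ 2)%R with (/ ((INR k + 2) / 2 * ((INR k + 2) / 2)))%R
    by (field; lra).
  apply Rinv_le_contravar; [nra | apply Rmult_le_compat; lra].
Qed.

Lemma ex_series_linear_div_cubic (c p q r s : C) :
  ex_series (fun k => Cmod (c * (INR k + s) / ((INR k + p) * (INR k + q) * (INR k + r)))).
Proof.
  (* With [t = INR k + 2], the numerator factor is at most [2 t] and each denominator factor at
     least [t / 2], whence [2 t / (t / 2)^3 = 16 / t^2]. *)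
  apply ex_series_eventually_inv_square with (16 * Cmod c)%R.
  apply (filter_imp (fun k => (((INR k + 2) / 2 <= Cmod (INR k + p))%R
                              /\ ((INR k + 2) / 2 <= Cmod (INR k + q))%R)
                              /\ (((INR k + 2) / 2 <= Cmod (INR k + r))%R
                              /\ (Cmod (INR k + s) <= 2 * (INR k + 2))%R)));
    [| repeat apply filter_and; apply Cmod_INR_plus_ge || apply Cmod_INR_plus_le].
  intros k [[Hp Hq] [Hr Hs]]; pose proof (pos_INR k) as Hk.
  rewrite Cmod_div.
  2:{ repeat apply Cmult_neq_0; apply Cmod_gt_0; lra. }
  rewrite !Cmod_mult.
  set (t := (INR k + 2)%R) in *.
  assert (Ht : (0 < t)%R) by (unfold t; lra).
  replace (16 * Cmod c * / t ^ 2)%R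
    with (Cmod c * (2 * t) * / (t / 2 * (t / 2) * (t / 2)))%R by (field; lra).
  apply Rmult_le_compat.
  - apply Rmult_le_pos; apply Cmod_ge_0.
  - left; apply Rinv_0_lt_compat; repeat apply Rmult_lt_0_compat; lra.
  - apply Rmult_le_compat_l; [apply Cmod_ge_0 | assumption].
  - apply Rinv_le_contravar; [repeat apply Rmult_lt_0_compat; lra |].
    apply Rmult_le_compat; [nra | lra | | assumption].
    apply Rmult_le_compat; lra.
Qed.

Lemma pochhammer_neq_0 (c : C) (j : nat) : not_integer c -> pochhammer c j <> 0.
Proof.
  intros Hc; induction j as [| j IH]; simpl; [apply C1_nz |].
  apply Cmult_neq_0; [assumption |].
  rewrite INR_IZR_INZ; apply not_integer_plus, Hc.
Qed.

(** Ratio test: consecutive terms have ratio [Cmod mu * x / Cmod (beta + j + 1)], which tends to 0.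
    The bounded factor [r] may vanish, so it is left out of the ratios and restored by
    comparison. *)
Lemma entire_pochhammer (beta mu : C) (r : nat -> C) (B : R) :
  mu <> 0 -> not_integer beta -> (forall j, (Cmod (r j) <= B)%R) ->
  entire_coef (fun j => mu ^ j / pochhammer beta (j + 1) * r j).
Proof.
  intros Hmu Hbeta Hr x Hx.
  set (a := fun j => (Cmod (mu ^ j / pochhammer beta (j + 1)) * x ^ j)%R).
  assert (Ha : forall j, (0 < a j)%R).
  { intros j; apply Rmult_lt_0_compat; [| apply pow_lt, Hx].
    apply Cmod_gt_0; intros H.
    apply (Cpow_nz mu j Hmu).
    rewrite <- (Cmult_0_l (pochhammer beta (j + 1))), <- H.
    field; apply pochhammer_neq_0, Hbeta. }
  assert (Hnz : forall j, INR j + (beta + 1) <> 0).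
  { intros j; not_integer_shift Hbeta (Z.of_nat j + 1)%Z. }
  assert (Hex : ex_series (fun j => Rabs (a j))).
  { apply (ex_series_DAlembert a 0); [lra | intros j; specialize (Ha j); lra |].
    apply (is_lim_seq_ext (fun j => Cmod mu * x * / Cmod (INR j + (beta + 1)))%R).
    - intros j.
      rewrite Rabs_pos_eq; [| left; apply Rdiv_lt_0_compat; apply Ha].
      unfold a; rewrite !Nat.add_1_r.
      change (pochhammer beta (S (S j))) with (pochhammer beta (S j) * (beta + INR (S j))).
      replace (mu ^ S j / (pochhammer beta (S j) * (beta + INR (S j))))
        with (mu ^ j / pochhammer beta (S j) * (mu / (INR j + (beta + 1)))).
      + rewrite Cmod_mult, (Cmod_div mu) by apply Hnz.
        specialize (Ha j); unfold a in Ha; rewrite Nat.add_1_r in Ha.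
        set (y := Cmod (mu ^ j / _)) in *; simpl.
        assert (y <> 0%R) by (intros E; rewrite E in Ha; lra).
        pose proof (pow_lt x j Hx); pose proof (proj1 (Cmod_gt_0 _) (Hnz j)).
        field; repeat split; lra || assumption.
      + rewrite S_INR, RtoC_plus, Cpow_S; field; repeat split.
        * intros E; apply (Hnz j); rewrite <- E; ring.
        * apply pochhammer_neq_0, Hbeta.
    - replace (Finite 0) with (Rbar_mult (Finite (Cmod mu * x)%R) (Rbar_inv p_infty))
        by (simpl; f_equal; ring).
      apply is_lim_seq_scal_l, is_lim_seq_inv; [| discriminate].
      apply is_lim_seq_le_p_loc with (fun j => / 2 * INR j)%R.
      + apply (filter_imp (fun j => ((INR j + 2) / 2 <= Cmod (INR j + (beta + 1)))%R));
          [intros; lra | apply Cmod_INR_plus_ge].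
      + replace p_infty with (Rbar_mult (Finite (/ 2)%R) p_infty).
        * apply is_lim_seq_scal_l, is_lim_seq_INR.
        * apply is_Rbar_mult_unique, is_Rbar_mult_sym, is_Rbar_mult_p_infty_pos; simpl; lra. }
  apply (ex_series_le (K := R_AbsRing) (V := R_CompleteNormedModule))
    with (b := fun j => (B * Rabs (a j))%R).
  - intros j.
    change (Rabs (Cmod (mu ^ j / pochhammer beta (j + 1) * r j) * x ^ j) <= B * Rabs (a j))%R.
    rewrite Cmod_mult.
    replace (Cmod (mu ^ j / pochhammer beta (j + 1)) * Cmod (r j) * x ^ j)%R
      with (Cmod (r j) * a j)%R by (unfold a; ring).
    rewrite Rabs_mult, Rabs_pos_eq by apply Cmod_ge_0.
    apply Rmult_le_compat_r; [apply Rabs_pos | apply Hr].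
  - apply (ex_series_scal (K := R_AbsRing) (V := R_NormedModule) B), Hex.
Qed.

(** * The two coefficient sequences and their recurrences *)

Section Coefficients.

Variables n lambda mu b : C.
Hypothesis hmu : mu <> RtoC 0.
Hypothesis hb : not_integer b.
Hypothesis hbn : not_integer (b + n).

Let alphaM (k : nat) : C := lambda / ((INR k + b) * (INR k + b + n - 1)).
Let betaM (k : nat) : C := mu ^ 2 / ((INR k + b) * (INR k + b + n - 1)).
Let alphaS (m : nat) : C := (lambda - n + 2) / ((b - INR m + 1) * (b - INR m + n - 2)).
Let betaS (m : nat) : C :=
  mu ^ 2 * (b - INR m + n - 1) / ((b - INR m + 1) * (b - INR m + n - 2) * (b - INR m + n - 3)).

Let summable_M (c : C) :
  ex_series (fun k => Cmod (c / ((INR k + b) * (INR k + b + n - 1)))).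
Proof.
  apply ex_series_ext with (2 := ex_series_inv_quadratic c b (b + n - 1)).
  intros k; do 3 f_equal; ring.
Qed.

Let summable_alphaS : ex_series (fun m => Cmod (alphaS m)).
Proof.
  apply ex_series_ext with (2 := ex_series_inv_quadratic (lambda - n + 2) (- b - 1) (2 - b - n)).
  intros m; unfold alphaS; do 2 f_equal; ring.
Qed.

Let summable_betaS : ex_series (fun m => Cmod (betaS m)).
Proof.
  apply ex_series_ext
    with (2 := ex_series_linear_div_cubic (mu ^ 2) (- b - 1) (2 - b - n) (3 - b - n) (1 - b - n)).
  intros m; unfold betaS; f_equal.
  assert (b - INR m + n - 3 <> 0) by not_integer_shift hbn (- Z.of_nat m - 3)%Z.
  assert (b - INR m + n - 2 <> 0) by not_integer_shift hbn (- Z.of_nat m - 2)%Z.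
  assert (b - INR m + 1 <> 0) by not_integer_shift hb (- Z.of_nat m + 1)%Z.
  (* Rewritten in terms of increasing [INR m], the numerator and the cubic denominator both change
     sign. *)
  replace (mu ^ 2 * (INR m + (1 - b - n))) with (- (mu ^ 2 * (b - INR m + n - 1))) by ring.
  replace ((INR m + (- b - 1)) * (INR m + (2 - b - n)) * (INR m + (3 - b - n)))
    with (- ((b - INR m + 1) * (b - INR m + n - 2) * (b - INR m + n - 3))) by ring.
  field; auto.
Qed.

Lemma ex_infprod_Mmat (k : nat) : ex_infprod (Mmat n lambda mu b) k.
Proof. exact (ex_infprod_companion alphaM betaM (summable_M lambda) (summable_M (mu ^ 2)) k). Qed.

Lemma ex_infprod_Smat (m : nat) : ex_infprod (Smat n lambda mu b) m.
Proof. exact (ex_infprod_companion alphaS betaS summable_alphaS summable_betaS m). Qed.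

(** [coef] at 0 belongs to [fminus], hence the separate value 0 here. With this value the recurrence
    is available only from degree 2 on; [d1p] is its left-hand side in degree 1. *)
Definition coef_plus (j : nat) : C :=
  match j with O => RtoC 0 | S _ => coef n lambda mu b (Z.of_nat j) end.

Definition coef_minus (m : nat) : C := coef n lambda mu b (- Z.of_nat m).

Lemma coef_plus_S (j : nat) :
  coef_plus (S j)
  = mu ^ S j / pochhammer b (S j + 1) * entry (Rmat n lambda mu b (S j)) 1 0.
Proof.
  unfold coef_plus, coef.
  destruct (Z.leb_spec 1 (Z.of_nat (S j))); [rewrite Nat2Z.id; reflexivity | lia].
Qed.

Lemma coef_minus_eq (m : nat) :
  coef_minus m
  = mu ^ m / pochhammer (2 - n - b) (m + 1) * entry (Tmat n lambda mu b m) 1 0.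
Proof.
  unfold coef_minus, coef.
  destruct (Z.leb_spec 1 (- Z.of_nat m)); [lia |].
  rewrite Z.opp_involutive, Nat2Z.id; reflexivity.
Qed.

Let not_integer_minus : not_integer (2 - n - b).
Proof. intros j E; apply (not_integer_plus _ hbn (j - 2)%Z).
  rewrite minus_IZR, RtoC_minus, <- E; ring.
Qed.

Lemma entire_coef_plus : entire_coef coef_plus.
Proof.
  pose (r := fun j => match j with O => RtoC 0 | S _ => entry (Rmat n lambda mu b j) 1 0 end).
  intros x Hx.
  apply ex_series_ext with (fun j => Cmod (mu ^ j / pochhammer b (j + 1) * r j) * x ^ j)%R.
  - intros [| j]; do 2 f_equal; [unfold r; simpl; ring | rewrite coef_plus_S; reflexivity].
  - eapply entire_pochhammer with (r := r); [assumption | assumption | | assumption].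
    intros [| j].
    + unfold r; rewrite Cmod_0; left; apply exp_pos.
    + exact (infprod_companion_bound alphaM betaM (summable_M lambda) (summable_M (mu ^ 2)) (S j)).
Qed.

Lemma entire_coef_minus : entire_coef coef_minus.
Proof.
  intros x Hx.
  apply ex_series_ext
    with (fun m => Cmod (mu ^ m / pochhammer (2 - n - b) (m + 1)
                         * entry (Tmat n lambda mu b m) 1 0) * x ^ m)%R.
  - intros m; rewrite coef_minus_eq; reflexivity.
  - eapply entire_pochhammer; [assumption | apply not_integer_minus | | assumption].
    exact (infprod_companion_bound alphaS betaS summable_alphaS summable_betaS).
Qed.

(** For [k = j + 2], taking out [mu ^ k / pochhammer b (k + 1)] leaves [(k + b) (k + b + n - 1)]
    times the relation between [R_(k-1,21)], [R_(k,21)] and [R_(k+1,21)]. *)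
Lemma coef_plus_recurrence (j : nat) :
  ((INR j + 2 + b) * (INR j + 2 + (b + n - 1)) + lambda) * coef_plus (S (S j))
  + mu * (INR j + 3 + b) * coef_plus (S (S (S j)))
  - mu * (INR j + 1 + (b + n)) * coef_plus (S j) = 0.
Proof.
  pose proof (infprod_companion_recurrence alphaM betaM (summable_M lambda)
                (summable_M (mu ^ 2)) (S j)) as Hr.
  rewrite !coef_plus_S, !Nat.add_1_r; unfold Rmat.
  change (Mmat n lambda mu b) with (companion alphaM betaM).
  rewrite Hr; unfold alphaM, betaM; clear Hr.
  set (r2 := entry _ 1 0); set (r3 := entry _ 1 0).
  change (pochhammer b (S (S (S (S j)))))
    with (pochhammer b (S (S j)) * (b + INR (S (S j))) * (b + INR (S (S (S j))))).
  change (pochhammer b (S (S (S j)))) with (pochhammer b (S (S j)) * (b + INR (S (S j)))).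
  pose proof (pochhammer_neq_0 b (S (S j)) hb) as Hp.
  assert (H1 : b + INR (S (S j)) <> 0) by not_integer_shift hb (Z.of_nat j + 2)%Z.
  assert (H2 : b + INR (S (S (S j))) <> 0) by not_integer_shift hb (Z.of_nat j + 3)%Z.
  assert (H3 : b + n + INR j + 1 <> 0) by not_integer_shift hbn (Z.of_nat j + 1)%Z.
  set (p := pochhammer b (S (S j))) in *; clearbody p r2 r3.
  rewrite !S_INR, !RtoC_plus in *; rewrite !Cpow_S.
  field; repeat split;
    first [assumption | nonzero_by H1 | nonzero_by H2 | nonzero_by H3].
Qed.

(** This is where the entries of [Smat] come from. Normalizing divides the diagonal
    [(b-m-1)(b-m+n-2) + lambda] by [(b-m)(b-m+n-3)]; the two products differ by [2 - n], hence the
    numerator [lambda - n + 2]. The raising factor [b-m+n-2] does not cancel against the Pochhammer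
    factors, hence the cubic denominator. *)
Lemma coef_minus_recurrence (m : nat) :
  ((INR m + 1 - b) * (INR m + 1 + (1 - n - b)) + lambda) * coef_minus (S m)
  + mu * (INR m + 2 - (b + n)) * coef_minus (S (S m))
  - mu * (INR m - b) * coef_minus m = 0.
Proof.
  pose proof (infprod_companion_recurrence alphaS betaS summable_alphaS
                summable_betaS m) as Hr.
  rewrite !coef_minus_eq, !Nat.add_1_r; unfold Tmat.
  change (Smat n lambda mu b) with (companion alphaS betaS).
  rewrite Hr; unfold alphaS, betaS; clear Hr.
  set (r2 := entry _ 1 0); set (r3 := entry _ 1 0).
  pose proof not_integer_minus as Hg.
  set (g := 2 - n - b) in *.
  change (pochhammer g (S (S (S m))))
    with (pochhammer g (S m) * (g + INR (S m)) * (g + INR (S (S m)))).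
  change (pochhammer g (S (S m))) with (pochhammer g (S m) * (g + INR (S m))).
  pose proof (pochhammer_neq_0 g (S m) Hg) as Hp.
  assert (H1 : b - INR m <> 0) by not_integer_shift hb (- Z.of_nat m)%Z.
  assert (H2 : g + INR (S m) <> 0) by not_integer_shift Hg (Z.of_nat m + 1)%Z.
  assert (H3 : g + INR (S (S m)) <> 0) by not_integer_shift Hg (Z.of_nat m + 2)%Z.
  set (p := pochhammer g (S m)) in *; clearbody p r2 r3.
  rewrite !S_INR, !RtoC_plus in *; rewrite !Cpow_S; unfold g in *.
  field; repeat split;
    first [assumption | nonzero_by H1 | nonzero_by H2 | nonzero_by H3].
Qed.

Lemma fplus_psum (z : C) :
  is_seriesC (fplus_term n lambda mu b z) (psum coef_plus z)
  /\ fplus n lambda mu b z = psum coef_plus z.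
Proof.
  assert (H : is_seriesC (fplus_term n lambda mu b z) (psum coef_plus z)).
  { apply (is_series_incr_1 (K := C_AbsRing) (V := C_NormedModule)
             (fun j => coef_plus j * z ^ j)).
    replace (plus _ _) with (psum coef_plus z); [apply is_series_psum, entire_coef_plus |].
    change (psum coef_plus z = psum coef_plus z + 0 * 1); ring. }
  split; [exact H | apply sumC_unique, H].
Qed.

End Coefficients.

Theorem lemma3p8 (n lambda mu b : C)
  (hmu : mu <> RtoC 0) (hb : not_integer b) (hbn : not_integer (b + n)) :
  let a := coef n lambda mu b in
  let d0p := mu * (b + 1) * a 1%Z in
  let d1p := ((b + 1) * (b + n) + lambda) * a 1%Z + mu * (b + 2) * a 2%Z in
  let d0m := (b * (b + n - 1) + lambda) * a 0%Z
             - mu * (b + n - 1) * a (-1)%Z in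
  let d1m := - (mu * (b + n) * a 0%Z) in
  (* the objects in the statement are well defined *)
  (forall k : nat, (1 <= k)%nat -> ex_infprod (Mmat n lambda mu b) k) /\
  (forall m : nat, ex_infprod (Smat n lambda mu b) m) /\
  (forall z : C, ex_seriesC (fplus_term n lambda mu b z)) /\
  (forall z : C, ex_seriesC (fminus_term n lambda mu b z)) /\
  (* the two identities, for every local branch of the power z^b *)
  (forall (U : C -> Prop) (ell : C -> C), log_branch U ell ->
    let Ep := fun z : C =>
      power_branch ell b z * fplus n lambda mu b z in
    let Em := fun z : C =>
      power_branch ell b z * fminus n lambda mu b (/ z) in
    twice_derivable_on U Ep /\
    twice_derivable_on U Em /\
    forall z : C, U z ->
      power_branch ell (- b) z * Lop n lambda mu Ep z = d0p + d1p * z /\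
      power_branch ell (- b) z * Lop n lambda mu Em z = d0m + d1m * z).
Proof.
  intros a d0p d1p d0m d1m.
  pose proof (entire_coef_plus n lambda mu b hmu hb) as Hcp.
  pose proof (entire_coef_minus n lambda mu b hmu hb hbn) as Hcm.
  split; [intros; apply ex_infprod_Mmat |].
  split; [intros; apply ex_infprod_Smat; assumption |].
  split; [intros z; eexists; apply fplus_psum; assumption |].
  split; [intros z; apply (ex_series_entire _ z Hcm) |].
  intros U ell HU Ep Em.
  set (cp := coef_plus n lambda mu b) in *; set (cm := coef_minus n lambda mu b) in *.
  destruct (Lop_power_branch n lambda mu b U ell (fplus n lambda mu b) (psum (dcoef cp))
              (psum (dcoef (dcoef cp))) HU) as [Hp1 Hp2].
  { intros z _; apply (is_derive_ext (K := C_AbsRing) (V := C_NormedModule) (psum cp));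
      [| apply is_deriveC_psum, Hcp].
    intros y; symmetry; apply fplus_psum; assumption. }
  { intros z _; apply is_deriveC_psum, entire_dcoef, Hcp. }
  set (v0 := fun z => psum cm (/ z)).
  set (v1 := fun z => psum (dcoef cm) (/ z)).
  set (v2 := fun z => psum (dcoef (dcoef cm)) (/ z)).
  assert (Hinv : forall z, U z -> is_deriveC Cinv z (- / z ^ 2)).
  { intros z Hz; apply is_deriveC_inv, (log_branch_neq_0 U ell); assumption. }
  (* These are the first two derivatives of [v0] by the chain rule; the first is nested as
     [/ z * (/ z * ...)] so that only the derivative of [Cinv] enters the product rule. *)
  destruct (Lop_power_branch n lambda mu b U ell v0 (fun z => / z * (/ z * (- (1) * v1 z)))
              (fun z => 2 / z ^ 3 * v1 z + / z ^ 4 * v2 z) HU) as [Hm1 Hm2].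
  { intros z Hz; pose proof (log_branch_neq_0 U ell z HU Hz) as Hz0.
    replace (/ z * (/ z * (- (1) * v1 z))) with (- / z ^ 2 * v1 z) by (field; assumption).
    apply (is_deriveC_comp (psum cm) Cinv); [apply is_deriveC_psum, Hcm | apply Hinv, Hz]. }
  { intros z Hz; pose proof (log_branch_neq_0 U ell z HU Hz) as Hz0.
    replace (2 / z ^ 3 * v1 z + / z ^ 4 * v2 z)
      with (- / z ^ 2 * (/ z * (- (1) * v1 z))
            + / z * (- / z ^ 2 * (- (1) * v1 z)
                     + / z * (RtoC 0 * v1 z + - (1) * (- / z ^ 2 * v2 z))))
      by (field; assumption).
    apply (is_deriveC_mult Cinv (fun y => / y * (- (1) * v1 y))); [apply Hinv, Hz |].
    apply (is_deriveC_mult Cinv (fun y => - (1) * v1 y)); [apply Hinv, Hz |].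
    apply (is_deriveC_mult (fun _ => - (1)) v1); [apply is_deriveC_const |].
    apply (is_deriveC_comp (psum (dcoef cm)) Cinv);
      [apply is_deriveC_psum, entire_dcoef, Hcm | apply Hinv, Hz]. }
  split; [exact Hp1 |]; split; [exact Hm1 |].
  intros z Hz; pose proof (log_branch_neq_0 U ell z HU Hz) as Hz0; split.
  - unfold Ep; rewrite Hp2 by assumption.
    rewrite (proj2 (fplus_psum n lambda mu b hmu hb z)); fold cp.
    (* The degree 0 term is 0 because [cp] vanishes at 0, so division by [z] leaves an affine
       function. *)
    assert (T := psum_three_term cp b (b + n - 1) lambda mu b (b + n) 0 d0p d1p z Hcp).
    replace (d0p + d1p * z) with ((0 + d0p * z + d1p * z ^ 2) / z) by (field; assumption).
    rewrite <- T; clear T; [field; assumption | | | |].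
    + change (cp 0%nat) with (RtoC 0); ring.
    + change (cp 0%nat) with (RtoC 0); unfold d0p; change (cp 1%nat) with (a 1%Z); ring.
    + change (cp 0%nat) with (RtoC 0); unfold d1p.
      change (cp 1%nat) with (a 1%Z); change (cp 2%nat) with (a 2%Z); ring.
    + apply coef_plus_recurrence; assumption.
  - change Em with (fun z => power_branch ell b z * v0 z).
    rewrite Hm2 by assumption.
    (* In [w = / z], the exponent [b + k] at [k = - m] is [-(m - b)]: all offsets change sign, and
       the raising offset [b + n] becomes the lowering one. Degrees 0 and 1 in [w] give [d1m] and
       [d0m], since the sum is multiplied by [z] afterwards. *)
    assert (T := psum_three_term cm (- b) (1 - n - b) lambda mu (- (b + n)) (- b)
                   d1m d0m 0 (/ z) Hcm).
    replace (d0m + d1m * z) with (z * (d1m + d0m * / z + 0 * (/ z) ^ 2)) by (field; assumption).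
    rewrite <- T; clear T; [unfold v0, v1, v2; field; assumption | | | |].
    + unfold d1m; change (cm 0%nat) with (a 0%Z); ring.
    + unfold d0m; change (cm 0%nat) with (a 0%Z); change (cm 1%nat) with (a (-1)%Z); ring.
    (* Here the coefficient at index 0 is the true [a_0], so the recurrence already holds in degree
       2, which is why that term vanishes. *)
    + rewrite <- (coef_minus_recurrence n lambda mu b hb hbn 0).
      change (coef_minus n lambda mu b) with cm; change (INR 0) with 0%R; ring.
    + intros j; rewrite <- (coef_minus_recurrence n lambda mu b hb hbn (S j)).
      change (coef_minus n lambda mu b) with cm; rewrite S_INR, RtoC_plus; ring.
Qed.
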